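(* Let $X$ be a Noetherian topological space, and let $Y$ be any one of the four spaces $\mathbb{P}(X)$, $\mathcal{H}(X)$, $\mathbb{P}^*(X)$, $\mathcal{H}^*(X)$, with the lower Vietoris topology. Then the topology of $Y$ is Alexandroff if and only if $X$ is essentially finite.
   Context: A topological space is Noetherian if every open subset is compact (every open cover has a finite subcover; no separation is assumed), equivalently every ascending sequence of open subsets is stationary. A topology is Alexandroff if every intersection of open sets is open. A topological space is essentially finite if it has only finitely many open subsets. $\mathbb{P}(X)$ is the set of all subsets of $X$ with the lower Vietoris topology, generated by the subbasic open sets $\Diamond U = \{A \in \mathbb{P}(X) \mid A \cap U \neq \emptyset\}$, $U$ open in $X$. $\mathbb{P}^*(X)$ is the subspace of non-empty subsets, $\mathcal{H}(X)$ the subspace of closed subsets of $X$, and $\mathcal{H}^*(X)$ the subspace of non-empty closed subsets of $X$; each has the subspace topology, also called the lower Vietoris topology. *)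

(* Defs.v *)
From HB Require Import structures.
From mathcomp Require Import all_boot all_order all_algebra.
From mathcomp Require Import all_classical.
From mathcomp Require Import topology.

Set Implicit Arguments.
Unset Strict Implicit.
Unset Printing Implicit Defensive.

Local Open Scope classical_set_scope.

(* [cover_compact] rather than the filter-based [compact]: the library relates the
   two only on pointed spaces, and [X] may be empty. *)
Definition noetherian_space (X : topologicalType) : Prop :=
  forall U : set X, open U -> cover_compact U.

Definition alexandroff (T : topologicalType) : Prop :=
  forall F : set (set T), F `<=` open -> open (\bigcap_(A in F) A).

Definition essentially_finite (X : topologicalType) : Prop :=
  finite_set [set U : set X | open U].

(* An alias of [set X], to carry the lower Vietoris topology. *)
Definition powerspace (X : topologicalType) : Type := set X.

Definition diamond (X : topologicalType) (U : set X) : set (powerspace X) :=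
  [set A : set X | A `&` U !=set0].

HB.instance Definition _ (X : topologicalType) :=
  Choice.copy (powerspace X) (set X).

HB.instance Definition _ (X : topologicalType) :=
  isSubBaseTopological.Build (powerspace X) (@open X) (@diamond X).

(* Coerced to types, the following sets carry the library's subspace topology
   (the initial topology of the inclusion into [powerspace X]). *)
Definition nonempty_powerspace (X : topologicalType) : set (powerspace X) :=
  [set A : set X | A !=set0].
Arguments nonempty_powerspace X : clear implicits.

Definition hyperspace (X : topologicalType) : set (powerspace X) :=
  [set A : set X | closed A].
Arguments hyperspace X : clear implicits.

Definition nonempty_hyperspace (X : topologicalType) : set (powerspace X) :=
  [set A : set X | closed A /\ A !=set0].
Arguments nonempty_hyperspace X : clear implicits.

(* Main.v *)
Require Import Defs.
From mathcomp Require Import all_boot all_order all_algebra.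
From mathcomp Require Import all_classical.
From mathcomp Require Import topology.

(** If [Y] is Alexandroff and [C] is a nonempty closed set, the set of all [B]
  in [Y] whose closure contains [C] is the intersection of the open sets
  [diamond U] with [U] open meeting [C]; hence it is open, and contains a basic
  neighborhood of [C], given by open sets [U_1, ..., U_n] meeting [C].  Thus
  every nonempty closed set properly contained in [C] misses some [U_i], i.e. is
  contained in [C \ U_i], a closed set strictly smaller than [C].  Noetherian
  induction on closed sets therefore shows that [X] has finitely many closed
  sets.  Conversely, if [X] has finitely many open sets, then each point [A] of
  [powerspace X] has a least neighborhood, the finite intersection of the
  [diamond U] with [U] meeting [A]. *)

Set Implicit Arguments.
Unset Strict Implicit.
Unset Printing Implicit Defensive.

Import finmap.
Local Open Scope classical_set_scope.

Lemma noetherian_stationary (X : topologicalType) (f : nat -> set X) :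
  noetherian_space X -> (forall n, open (f n)) ->
  (forall n, f n `<=` f n.+1) -> exists n, f n.+1 `<=` f n.
Proof.
move=> X_noeth f_open f_incr.
have f_homo : {homo f : i j / (i <= j)%N >-> i `<=` j}.
  exact: homo_leq (@subset_refl X) (@subset_trans X) f_incr.
have f_union_open : open (\bigcup_n f n) by exact: bigcup_open.
have [D _ D_cover] : finite_subset_cover setT f (\bigcup_n f n).
  exact: (X_noeth _ f_union_open).
(* Every index in the finite subcover is at most this maximum, so the chain has already reached its
   union there. *)
exists (\max_(i <- D) i)%N => x fx.
have /D_cover[i iD fix_] : (\bigcup_n f n) x by exists (\max_(i <- D) i).+1%N.
by apply: f_homo fix_; apply: leq_bigmax_seq.
Qed.

(** Otherwise dependent choice yields a strictly decreasing sequence of closed counterexamples,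
    whose complements contradict stationarity. *)
Lemma noetherian_closed_ind (X : topologicalType) (P : set X -> Prop) :
  noetherian_space X ->
  (forall C, closed C ->
     (forall D, closed D -> D `<` C -> P D) -> P C) ->
  forall C, closed C -> P C.
Proof.
move=> X_noeth step C0 C0_closed; apply: contrapT => nPC0.
pose T := {C : set X | closed C /\ ~ P C}.
pose R (C D : T) := sval D `<` sval C.
have R_total C : {D | R C D}.
  apply: cid; case: C => C [C_closed nPC]; apply: contrapT => noD.
  apply: (nPC); apply: step => // D D_closed DC; apply: contrapT => nPD.
  by apply: noD; exists (exist _ D (conj D_closed nPD)).
have [f [_ fR]] := dependent_choice R_total (exist _ C0 (conj C0_closed nPC0)).
have [||n] := @noetherian_stationary X (fun n => ~` sval (f n)) X_noeth.
- by move=> n; apply: closed_openC; case: (svalP (f n)).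
- by move=> n; apply: subsetC; case: (fR n).
- by move=> /subsetCP; case: (fR n).
Qed.

Lemma open_diamond (X : topologicalType) (U : set X) :
  open U -> open (diamond U).
Proof.
move=> U_open; exists [set diamond U]; last by rewrite bigcup_set1.
by move=> _ ->; apply: finI_from1.
Qed.

Lemma open_powerspace_nbhs (X : topologicalType) (O : set (powerspace X))
    (A : powerspace X) :
  open O -> O A ->
  exists2 D : {fset set X},
    forall U, U \in D -> open U /\ diamond U A &
    \bigcap_(U in [set` D]) diamond U `<=` O.
Proof.
move=> [E E_fin <-] [N EN NA]; have [D D_open DN] := E_fin _ EN.
exists D => [U UD|B BD]; last by exists N => //; rewrite -DN.
split; first exact: set_mem (D_open _ UD).
by move: NA; rewrite -DN; apply.
Qed.

Lemma alexandroff_subspace (T : topologicalType) (S : set T) :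
  alexandroff T -> alexandroff S.
Proof.
move=> T_alex F F_open.
(* Using all open sets whose trace lies in [F] avoids choosing an extension of each member. *)
exists (\bigcap_(O in [set O | open O /\ F (set_val @^-1` O)]) O).
  by apply: T_alex => O [].
rewrite predeqE => x; split=> [xF A FA|xF O [_ FO]]; last exact: (xF _ FO).
by have [O O_open OA] := F_open _ FA; rewrite -OA; apply: xF; split; rewrite ?OA.
Qed.

Lemma essentially_finite_alexandroff (X : topologicalType) :
  essentially_finite X -> alexandroff (powerspace X).
Proof.
move=> X_fin F F_open; rewrite openE => A FA.
pose nbrs := [set U : set X | open U /\ diamond U A].
have nbrs_fin : finite_set nbrs by apply: sub_finite_set X_fin => U [].
rewrite /interior nbhsE /=.
exists (\bigcap_(U in nbrs) diamond U); last first.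
  move=> B BA O FO.
  have [D DA] := open_powerspace_nbhs (F_open _ FO) (FA _ FO).
  by apply => U /DA; apply: BA.
split; last by move=> U [].
(* The complement of this finite intersection is a finite union of closed sets. *)
rewrite -(fset_setK nbrs_fin) -[X in open X]setCK setC_bigcap.
apply: closed_openC; apply: closed_bigcup => // U.
rewrite /= in_fset_set // => /set_mem[U_open _].
exact: open_closedC (open_diamond U_open).
Qed.

Lemma alexandroff_closed_nbhs (X : topologicalType) (S : set (powerspace X))
    (C : set X) :
  alexandroff S -> S C ->
  exists2 D : {fset set X},
    forall U, U \in D -> open U /\ C `&` U !=set0 &
    forall B, S B -> (forall U, U \in D -> B `&` U !=set0) -> C `<=` closure B.
Proof.
move=> S_alex SC.
pose F := [set (set_val @^-1` diamond U : set S) |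
  U in [set U | open U /\ diamond U C]].
have /S_alex[O O_open OF] : F `<=` open.
  by move=> _ [U [U_open _] <-]; exists (diamond U) => //; apply: open_diamond.
have inS (B : powerspace X) (SB : S B) :
    O B <-> forall A, F A -> A (SigSub (mem_set SB)).
  by rewrite -[O B]/((set_val @^-1` O) (SigSub (mem_set SB))) OF.
have OC : O C by apply/(inS _ SC) => _ [U [_ UC] <-].
have [D DC DO] := open_powerspace_nbhs O_open OC.
(* An open [U] containing [x] meets [C] at [x], so the trace of [diamond U] belongs to [F] and [B]
   meets [U]. *)
exists D => // B SB BD x Cx V; rewrite nbhsE => -[U [U_open Ux] UV].
have /(inS _ SB)/(_ (set_val @^-1` diamond U)) : O B by apply: DO => W; apply: BD.
case=> [|y [By Uy]]; last by exists y; split=> //; apply: UV.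
by exists U => //; split=> //; exists x.
Qed.

Lemma alexandroff_essentially_finite (X : topologicalType)
    (S : set (powerspace X)) :
  noetherian_space X -> nonempty_hyperspace X `<=` S -> alexandroff S ->
  essentially_finite X.
Proof.
move=> X_noeth S_sub S_alex.
(* Relativized to [C] for the induction; the case of the whole space gives the open sets by
   complementation. *)
suff closed_fin C : closed C -> finite_set [set D : set X | closed D /\ D `<=` C].
  apply: (@sub_finite_set _ _
    (setC @` [set D : set X | closed D /\ D `<=` setT])).
    by move=> U U_open; exists (~` U); rewrite ?setCK //; split=> //;
      apply: open_closedC.
  exact/finite_image/closed_fin/closedT.
move: C; apply: noetherian_closed_ind => // C C_closed IH.
(* The empty set need not belong to [S], so it is treated apart. *)
have [->|/set0P C_neq0] := eqVneq C set0.
  by apply: sub_finite_set (finite_set1 set0) => D [_]; rewrite subset0.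
have [N NC N_least] := alexandroff_closed_nbhs S_alex (S_sub C (conj C_closed C_neq0)).
apply: (@sub_finite_set _ _ ([set C; set0] `|`
  \bigcup_(U in [set` N]) [set D | closed D /\ D `<=` C `\` U])).
  move=> D [D_closed DC].
  have [->|/set0P D_neq0] := eqVneq D set0; first by left; right.
  (* If [D] meets every member of [N], it is dense in [C], hence equal to [C]; otherwise it lies in
     some [C] minus [U]. *)
  have [|] := pselect (forall U, U \in N -> D `&` U !=set0).
    move/(N_least D (S_sub D (conj D_closed D_neq0))).
    by rewrite -(closure_id D).1 // => CD; left; left; apply/seteqP.
  move=> /existsNP[U /not_implyP[UN DU]]; right; exists U => //; split=> //.
  by move=> x Dx; split; [exact: DC|move=> Ux; apply: DU; exists x].
rewrite finite_setU; split; first exact: finite_set2.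
apply: bigcup_finite => // U UN; have [U_open [x [Cx Ux]]] := NC _ UN.
apply: IH; last by split=> [y []//|/(_ _ Cx)[]].
by rewrite setDE; apply: closedI => //; apply: open_closedC.
Qed.

Theorem proposition3p4 (X : topologicalType) (X_noeth : noetherian_space X) :
  [/\ alexandroff (powerspace X) <-> essentially_finite X,
      alexandroff (hyperspace X) <-> essentially_finite X,
      alexandroff (nonempty_powerspace X) <-> essentially_finite X
    & alexandroff (nonempty_hyperspace X) <-> essentially_finite X].
Proof.
have sub_iff (S : set (powerspace X)) : nonempty_hyperspace X `<=` S ->
    alexandroff S <-> essentially_finite X.
  move=> S_sub; split; first exact: alexandroff_essentially_finite.
  by move/essentially_finite_alexandroff; apply: alexandroff_subspace.
split; [|by apply: sub_iff => ? []..|exact: sub_iff].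
split; last exact: essentially_finite_alexandroff.
(* The full [powerspace X] is a type rather than a subset [S], so the property is first restricted
   to a subspace. *)
move/(@alexandroff_subspace _ (nonempty_hyperspace X)).
exact: alexandroff_essentially_finite.
Qed.
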